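(* Let $n\geqslant 6$ and let $i<j<n$ be positive integers with $1\notin\{i,j\}$. Then the set $S_{\{i,j\}_{n}^{1}}$ is Laplacian realizable if and only if $j=n-1$ and one of the following holds: (i) $n\equiv 0 \pmod 4$ and $i=2k$ for some $k\in\{1,2,\ldots,\frac{n-2}{2}\}$; (ii) $n\equiv 1 \pmod 4$ and $i=2k$ for some $k\in\{1,2,\ldots,\frac{n-3}{2}\}$; (iii) $n\equiv 2 \pmod 4$ and $i=2k+1$ for some $k\in\{1,2,\ldots,\frac{n-4}{2}\}$; (iv) $n\equiv 3 \pmod 4$ and $i=2k+1$ for some $k\in\{1,2,\ldots,\frac{n-3}{2}\}$.
   Context: For a simple graph $G$, its Laplacian spectrum is the multiset of eigenvalues of $L(G)=D-A$ ($D$ the degree diagonal matrix, $A$ the adjacency matrix). For integers $0<i<j\leqslant n$ and $m\in\{1,\dots,n\}\setminus\{i,j\}$, $S_{\{i,j\}_{n}^{m}}$ denotes the multiset $\{0,1,\ldots,m-1,m,m,m+1,\ldots,n\}\setminus\{i,j\}$ (all integers $0,\dots,n$ each once, except $m$ appearing twice, with $i$ and $j$ removed). A multiset $S$ is called Laplacian realizable if there is a simple connected graph whose Laplacian spectrum (with multiplicities) equals $S$. *)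

(* Defs.v *)
From mathcomp Require Import all_boot all_order all_algebra all_field.

Set Implicit Arguments.
Unset Strict Implicit.
Unset Printing Implicit Defensive.

Import GRing.Theory.
Local Open Scope ring_scope.

Record sgraph := SGraph {
  vertex :> finType;
  adj : rel vertex;
  adj_sym : symmetric adj;
  adj_irrefl : irreflexive adj
}.

Definition connected_graph (G : sgraph) : Prop :=
  (0 < #|G|)%N /\ forall x y : G, connect (@adj G) x y.

Definition degree (G : sgraph) (x : G) : nat := #|[set y | adj x y]|.

Definition adjacency_mx (R : nzRingType) (G : sgraph) : 'M[R]_#|G| :=
  \matrix_(i, j) (adj (enum_val i : G) (enum_val j))%:R.

Definition degree_mx (R : nzRingType) (G : sgraph) : 'M[R]_#|G| :=
  diag_mx (\row_i (degree (enum_val i : G))%:R).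

Definition laplacian (R : nzRingType) (G : sgraph) : 'M[R]_#|G| :=
  degree_mx R G - adjacency_mx R G.

(* Multisets are sequences compared by perm_eq. The eigenvalues, with their   *)
(* multiplicities, are taken in algC, over which the characteristic           *)
(* polynomial of a matrix with algebraic coefficients splits.                 *)
Definition spectrum (n : nat) (A : 'M[algC]_n) : seq algC :=
  sval (closed_field_poly_normal (char_poly A)).

Lemma char_poly_spectrum (n : nat) (A : 'M[algC]_n) :
  char_poly A = \prod_(z <- spectrum A) ('X - z%:P).
Proof.
rewrite /spectrum; case: closed_field_poly_normal => s /= {1}->.
by rewrite (monicP (char_poly_monic A)) scale1r.
Qed.

Definition laplacian_realizable (S : seq algC) : Prop :=
  exists2 G : sgraph, connected_graph G & perm_eq (spectrum (laplacian algC G)) S.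

(* m occurs twice (once in the iota) provided that m <= n and m is not        *)
(* i or j.                                                                    *)
Definition S_set (i j n m : nat) : seq nat :=
  [seq k <- m :: iota 0 n.+1 | k \notin [:: i; j]].

(* Main.v *)
(* Sufficiency.  Disjoint unions concatenate Laplacian spectra and            *)
(* complementation maps eigenvalues on the orthogonal of the constants by     *)
(* k |-> n - k, so that a cone raises them by one.  Every set                 *)
(* {0, ..., N} \ {i} with 0 < i < N whose sum is even is the spectrum of some *)
(* graph S(N, i): take the complement of K_1 + S(N - 1, N - i) if i > 1, and  *)
(* of K_2 + S(N - 2, 2) if i = 1 < N - 1, starting from S(2, 1) = K_2.  The   *)
(* required graph is then the cone over 2 K_1 + S(n - 3, i - 1), or over      *)
(* K_1 + K_2 + S(n - 4, 2) when i = n - 2.                                    *)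
(*                                                                            *)
(* Necessity.  The trace is twice the number of edges, hence even: this gives *)
(* the conditions on i.  If j <> n - 1, then n - 1 and n are eigenvalues and  *)
(* 1 is a double one.  An eigenvector for n splits G as a join; because 1 is  *)
(* an eigenvalue, one side is a single vertex v.  The eigenvectors for 1      *)
(* vanish at v and are constant on the components of G - v, so these are at   *)
(* least three, whence the complement of G - v contains a complete tripartite *)
(* graph and its nonzero eigenvalues are at least 2.  But an eigenvector for  *)
(* n - 1 has eigenvalue 1 there.                                              *)
Require Import Defs.
From mathcomp Require Import all_boot all_order all_algebra all_field.
From mathcomp Require Import perm spectral zify ring.

Set Implicit Arguments.
Unset Strict Implicit.
Unset Printing Implicit Defensive.

Import Order.TTheory GRing.Theory Num.Theory.
Local Open Scope ring_scope.

(** The trace of a Laplacian is twice the number of edges, so the sum of a realizable multiset is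
    even ([lspec_sum_even]). For [j = n - 1] that sum is ['C(n, 2) + 2 - i]; by [odd_bin2] its
    evenness, given [1 < i < n - 1], is exactly the disjunction (i)-(iv). This parity also suffices:
    [lspec_S_set_realizable] takes the cone over a disjoint union with a summand from
    [lspec_interval_minus], and [lspec_union] and [lspec_compl] track the spectra.

    That [j = n - 1] is forced is [pred_card_notin_lspec]: on [n] vertices the eigenvalues [n],
    [n - 1] and a double 1 cannot coexist. Its proof compares Dirichlet energies. Level sets of
    eigenfunctions that are pairwise completely joined, in the graph or in its complement, span a
    complete multipartite graph, and [multipartite_energy] makes nonzero eigenvalues at least 2
    unless one level set misses at most one vertex. For the eigenvalue [n] the exception gives a
    universal vertex [v] ([universal_vertex]); for the double 1 it contradicts independence, and the
    bound excludes [n - 1]. *)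

(** * Characteristic polynomials and determinants *)

(** The sizes are kept distinct because [#|union G H|] and [#|G| + #|H|] are not convertible. *)
Lemma char_poly_reindex (R : comNzRingType) (m n : nat) (A : 'M[R]_n)
    (h : 'I_m -> 'I_n) :
  bijective h -> char_poly (mxsub h h A) = char_poly A.
Proof.
move=> bij_h; have eq_mn : m = n.
  by move/bij_eq_card: bij_h; rewrite !card_ord.
case: n / eq_mn A h bij_h => A h bij_h.
pose s := perm (bij_inj bij_h).
have -> : char_poly (mxsub h h A)
    = \det (row_perm s (col_perm s (char_poly_mx A))).
  congr (\det _); apply/matrixP => i j.
  by rewrite !mxE !permE (inj_eq (bij_inj bij_h)).
rewrite row_permE col_permE !det_mulmx !det_perm mulrCA -signr_addb odd_permV.
by rewrite addbb expr0 mulr1.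
Qed.

(* Sylvester's determinant identity for a rank-one perturbation in the        *)
(* direction of an eigenvector: scaling by y avoids inverting A.              *)
Lemma det_add_rank1 (R : comNzRingType) (n : nat) (A : 'M[R]_n)
    (u : 'cV_n) (v : 'rV_n) (y : R) :
  A *m u = y *: u -> y * \det (A + u *m v) = (y + (v *m u) 0 0) * \det A.
Proof.
move=> Au; pose M := block_mx A u (- v) 1%:M.
have detM : \det M = \det (A + u *m v).
  have := congr1 (@determinant _ _) (mulmx_block A u (- v) 1%:M 1%:M 0 v 1%:M).
  rewrite !(mulmx1, mulmx0, mul1mx, add0r, addNr) det_mulmx det_lblock !det1.
  by rewrite !mulr1 det_ublock det1 mulr1.
have := congr1 (@determinant _ _) (mulmx_block A u (- v) 1%:M 1%:M (- u) 0 y%:M).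
rewrite !(mulmx1, mulmx0, mul1mx, add0r, addr0) det_mulmx -/M detM.
rewrite mulmxN Au mul_mx_scalar addNr det_ublock det_lblock det1 det_scalar1.
rewrite mul1r mulrC => ->; rewrite mulrC; congr (_ * _).
by rewrite det_mx11 mxE mulNmx mulmxN opprK addrC [y%:M 0 0]mxE eqxx mulr1n.
Qed.

(** * The Laplacian and integral spectra *)

Lemma degree_sum (G : sgraph) (x : G) : degree x = (\sum_y adj x y)%N.
Proof.
rewrite /degree -sum1_card big_mkcond; apply: eq_bigr => y _; rewrite inE.
by case: (adj _ _).
Qed.

Lemma laplacianE (R : nzRingType) (G : sgraph) (i j : 'I_#|G|) :
  laplacian R G i j
  = (i == j)%:R * (degree (enum_val i))%:R - (adj (enum_val i) (enum_val j))%:R.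
Proof. by rewrite !mxE mulr_natl. Qed.

(** Stated on characteristic polynomials so that determinant identities apply directly. *)
Definition lspec (G : sgraph) (s : seq nat) : Prop :=
  char_poly (laplacian algC G) = \prod_(k <- s) ('X - (k%:R)%:P).

Lemma lspec_size (G : sgraph) (s : seq nat) : lspec G s -> size s = #|G|.
Proof.
move/(congr1 (size : {poly algC} -> nat)).
by rewrite size_char_poly size_prod_XsubC => -[].
Qed.

Lemma lspec_perm (G : sgraph) (s t : seq nat) : perm_eq s t -> lspec G s -> lspec G t.
Proof. by move=> st; rewrite /lspec (perm_big _ st). Qed.

Lemma lspec_realizable (G : sgraph) (s : seq nat) :
  connected_graph G -> lspec G s -> laplacian_realizable [seq k%:R | k <- s].
Proof.
move=> cG Gs; exists G => //; apply: prod_XsubC_eq.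
by rewrite -char_poly_spectrum big_map.
Qed.

(** * Spectra of complements, disjoint unions and cones *)

Definition single_adj (x y : unit) := false.
Definition single : sgraph :=
  @SGraph unit single_adj (fun _ _ => erefl) (fun _ => erefl).

Definition compl_adj (G : sgraph) (x y : G) := (x != y) && ~~ adj x y.
Lemma compl_adj_sym (G : sgraph) : symmetric (@compl_adj G).
Proof. by move=> x y; rewrite /compl_adj eq_sym adj_sym. Qed.
Lemma compl_adj_irrefl (G : sgraph) : irreflexive (@compl_adj G).
Proof. by move=> x; rewrite /compl_adj eqxx. Qed.
Definition compl (G : sgraph) : sgraph :=
  SGraph (@compl_adj_sym G) (@compl_adj_irrefl G).

Lemma degree_compl (G : sgraph) (x : G) : (@degree (compl G) x + degree x).+1 = #|G|.
Proof.
rewrite !degree_sum -big_split /= -sum1_card (bigD1 x) //= adj_irrefl.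
rewrite /compl_adj eqxx add0n [RHS](bigD1 x) //= add1n; congr _.+1.
by apply: eq_bigr => y; rewrite eq_sym => ->; case: (adj _ _).
Qed.

Lemma laplacian_compl (R : nzRingType) (G : sgraph) :
  laplacian R (compl G) = #|G|%:R%:M - const_mx 1 - laplacian R G.
Proof.
apply/matrixP => i j; rewrite laplacianE !mxE /= /compl_adj.
rewrite (inj_eq enum_val_inj); have [->|_] := eqVneq i j.
  rewrite !mulr1n mul1r subr0 adj_irrefl subr0 -(@degree_compl G (enum_val j)).
  by rewrite -addn1 !natrD !addrK.
rewrite !mulr0n mul0r !sub0r opprK.
by case: (adj _ _); rewrite ?subrr ?oppr0 ?addNr ?addr0.
Qed.

Lemma laplacian_const (R : nzRingType) (G : sgraph) :
  laplacian R G *m const_mx 1 = 0 :> 'cV_#|G|.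
Proof.
apply/matrixP => i j; rewrite !mxE.
under eq_bigr => k _ do rewrite laplacianE mxE mulr1.
rewrite big_split /= (bigD1 i) //= eqxx mul1r big1 ?addr0; last first.
  by move=> k; rewrite eq_sym => /negbTE ->; rewrite mul0r.
rewrite degree_sum natr_sum (reindex _ (onW_bij _ (enum_val_bij _))) /=.
by rewrite sumrN subrr.
Qed.

(** Up to sign, the characteristic matrix of the complement is [B = (n - X) - L] minus the all-ones
    matrix. The constant vector is an eigenvector of [B], so [det_add_rank1] removes the
    perturbation without diagonalizing. *)
Lemma lspec_compl (G : sgraph) (s : seq nat) :
  lspec G (0%N :: s) -> all (fun k => k <= #|G|)%N s ->
  lspec (compl G) (0%N :: [seq (#|G| - k)%N | k <- s]).
Proof.
move=> Gs /allP s_le; rewrite /lspec; set n := #|G|.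
have sz := lspec_size Gs; rewrite /= in sz.
pose L := map_mx polyC (laplacian algC G).
pose y : {poly algC} := n%:R%:P - 'X.
pose B := y%:M - L.
have Bu : B *m const_mx 1 = y *: const_mx 1 :> 'cV_n.
  rewrite mulmxBl mul_scalar_mx -[X in _ - X]/(_ *m _).
  suff -> : L *m const_mx 1 = 0 :> 'cV_n by rewrite subr0.
  have -> : const_mx 1 = map_mx polyC (const_mx 1) :> 'cV[{poly algC}]_n.
    by apply/matrixP => a b; rewrite !mxE.
  by rewrite -map_mxM laplacian_const map_mx0.
have detB : \det B = char_poly (laplacian algC G) \Po y.
  rewrite /char_poly -[RHS](det_map_mx (comp_poly y)); congr (\det _).
  apply/matrixP => i k; rewrite !mxE /= comp_polyB comp_polyC -mulr_natr.
  by rewrite rmorphMn /= comp_polyX mulr_natr.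
have detC : char_poly (laplacian algC (compl G))
    = (-1) ^+ n * \det (B + const_mx 1 *m (const_mx (-1) : 'rV_n)).
  rewrite -detZ /char_poly; congr (\det _).
  rewrite /char_poly_mx laplacian_compl; apply/matrixP => i k.
  rewrite !mxE big_ord1 !mxE /y.
  rewrite !(polyCB, polyCN) polyCMn !mulrnBl polyC1; ring.
have := det_add_rank1 (const_mx (-1)) Bu.
(* The all-ones matrix has eigenvalue [n] on constants, and [y - n = - 'X] restores the eigenvalue
   0. *)
have -> : y + ((const_mx (-1) : 'rV_n) *m (const_mx 1 : 'cV_n)) 0 0 = - 'X.
  rewrite mxE; under eq_bigr => k _ do rewrite !mxE mulr1.
  by rewrite sumr_const card_ord mulNrn /y polyCMn polyC1 addrAC subrr add0r.
rewrite {}detB Gs big_cons subr0 comp_polyM comp_polyX mulrCA.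
(* The eigenvalue 0 of [G] contributes a factor [y] to the determinant of [B], which cancels. *)
have y0 : y != 0.
  by rewrite -size_poly_eq0 /y -opprB size_polyN size_XsubC.
move/(mulfI y0) => detE; rewrite {}detC {}detE big_cons subr0.
rewrite big_map rmorph_prod /= mulrA mulrN -!mulNr mulrAC.
rewrite /n -{1}sz exprS mulN1r opprK mulrC; congr (_ * _).
elim: s s_le {Gs sz} => [|k s IHs] s_le; first by rewrite !big_nil mulr1.
rewrite !big_cons -[size _]/(size s).+1 exprS mulrACA IHs; last first.
  by move=> l sl; apply: s_le; rewrite inE sl orbT.
congr (_ * _); rewrite comp_polyB comp_polyX comp_polyC mulN1r /y.
by rewrite natrB ?s_le ?mem_head // polyCB; ring.
Qed.

Definition union_adj (G H : sgraph) (x y : G + H) : bool :=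
  match x, y with
  | inl a, inl b => adj a b
  | inr a, inr b => adj a b
  | _, _ => false
  end.
Lemma union_adj_sym (G H : sgraph) : symmetric (@union_adj G H).
Proof. by case=> x [] y //=; apply: adj_sym. Qed.
Lemma union_adj_irrefl (G H : sgraph) : irreflexive (@union_adj G H).
Proof. by case=> x /=; apply: adj_irrefl. Qed.
Definition union (G H : sgraph) : sgraph :=
  SGraph (@union_adj_sym G H) (@union_adj_irrefl G H).

Lemma degree_unionl (G H : sgraph) (x : G) :
  @degree (union G H) (inl x) = degree x.
Proof. by rewrite !degree_sum big_sumType /= [X in (_ + X)%N]big1 ?addn0. Qed.

Lemma degree_unionr (G H : sgraph) (x : H) :
  @degree (union G H) (inr x) = degree x.
Proof. by rewrite !degree_sum big_sumType /= big1. Qed.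

Lemma lspec_union (G H : sgraph) (s t : seq nat) :
  lspec G s -> lspec H t -> lspec (union G H) (s ++ t).
Proof.
move=> Gs Ht; rewrite /lspec big_cat /= -Gs -Ht.
pose f (i : 'I_(#|G| + #|H|)) : union G H :=
  match split i with inl a => inl (enum_val a) | inr b => inr (enum_val b) end.
pose g (x : union G H) : 'I_(#|G| + #|H|) :=
  match x with
  | inl a => lshift #|H| (enum_rank a) | inr b => rshift #|G| (enum_rank b)
  end.
have fK : cancel f g.
  by move=> i; rewrite /f; case: (split_ordP i) => k ->; rewrite /g enum_valK.
have gK : cancel g f.
  case=> x; rewrite /f /g; case: split_ordP => k //.
  - by move/lshift_inj <-; rewrite enum_rankK.
  - by move/eqP; rewrite eq_lrshift.
  - by move/eqP; rewrite eq_rlshift.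
  - by move/rshift_inj <-; rewrite enum_rankK.
pose h i := enum_rank (f i).
have bij_h : bijective h.
  by exists (g \o enum_val) => i; rewrite /h /= ?enum_rankK ?fK ?gK ?enum_valK.
rewrite -(char_poly_reindex _ bij_h).
have -> : mxsub h h (laplacian algC (union G H))
  = block_mx (laplacian algC G) 0 0 (laplacian algC H).
  apply/matrixP => i k; rewrite mxE laplacianE (bij_eq bij_h) !enum_rankK /f.
  case: (split_ordP i) => a ->; case: (split_ordP k) => b ->.
  - by rewrite block_mxEul laplacianE degree_unionl eq_lshift.
  - by rewrite block_mxEur mxE eq_lrshift mul0r subr0.
  - by rewrite block_mxEdl mxE eq_rlshift mul0r subr0.
  - by rewrite block_mxEdr laplacianE degree_unionr eq_rshift.
by rewrite /char_poly char_block_diag_mx det_ublock.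
Qed.

Lemma lspec_single : lspec single [:: 0%N].
Proof.
rewrite /lspec big_seq1; have n1 : #|single| = 1%N by rewrite card_unit.
rewrite /char_poly; have -> : char_poly_mx (laplacian algC single) = 'X%:M.
  apply/matrixP => i k; rewrite !mxE degree_sum big1 // mul0rn subrr subr0.
  by [].
by rewrite det_scalar n1 subr0.
Qed.

(** The join of a vertex with [G], written with complements so that its spectrum follows from
    [lspec_compl] and [lspec_union]. *)
Definition cone (G : sgraph) : sgraph := compl (union single (compl G)).

Lemma lspec_cone (G : sgraph) (s : seq nat) :
  lspec G (0%N :: s) -> all (fun k => k <= #|G|)%N s ->
  lspec (cone G) [:: 0%N, #|G|.+1 & map succn s].
Proof.
move=> Gs s_le.
have cU : #|union single (compl G)| = #|G|.+1 by rewrite card_sum card_unit.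
have /lspec_compl := lspec_union lspec_single (lspec_compl Gs s_le).
rewrite cU /= => /(_ _); rewrite subn0 -map_comp.
have -> : [seq ((subn #|G|.+1) \o (subn #|G|)) k | k <- s] = map succn s.
  by apply/eq_in_map => k ks /=; have /= := allP s_le k ks; lia.
by apply; rewrite all_map; apply/allP => k _ /=; lia.
Qed.

Lemma cone_connected (G : sgraph) : connected_graph (cone G).
Proof.
split; first by apply/card_gt0P; exists (inl tt).
have c x : connect (@adj (cone G)) (inl tt) x.
  by case: x => [[]|x]; [apply: connect0|apply: connect1].
move=> x y; apply: connect_trans (c y).
by rewrite (sym_connect_sym (@adj_sym _)).
Qed.

Definition edge : sgraph := compl (union single single).

Lemma card_edge : #|edge| = 2.
Proof. by rewrite card_sum card_unit. Qed.

Lemma lspec_edge : lspec edge [:: 0; 2]%N.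
Proof.
have /lspec_compl := lspec_union lspec_single lspec_single.
by rewrite card_sum card_unit /=; apply.
Qed.

(** * Sufficiency: graphs with prescribed spectra *)

Lemma uniq_map_subn (m : nat) (s : seq nat) :
  all (fun k => k <= m)%N s -> uniq [seq (m - k)%N | k <- s] = uniq s.
Proof.
move=> /allP s_le; apply: map_inj_in_uniq => a b /s_le a_le /s_le b_le; lia.
Qed.

Lemma mem_map_subn (m k : nat) (s : seq nat) :
  all (fun k => k <= m)%N s ->
  (k \in [seq (m - k)%N | k <- s]) = (k <= m)%N && ((m - k)%N \in s).
Proof.
move=> /allP s_le; apply/mapP/andP => [[l ls ->]|[k_le ks]].
  by rewrite leq_subr subKn ?s_le.
by exists (m - k)%N; rewrite ?subKn.
Qed.

Lemma lspec_interval_minus (N i : nat) :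
  (0 < i < N)%N -> odd 'C(N.+1, 2) = odd i ->
  exists2 G : sgraph, #|G| = N & lspec G (0%N :: [seq k <- iota 1 N | k != i]).
Proof.
elim/ltn_ind: N i => N IHN i /andP[i_gt0 i_lt] par.
(* For [i = 1] the value [N - i] is not an admissible gap for [N.-1]. *)
have [i1|i_neq1] := eqVneq i 1%N; last first.
  have parN : odd 'C(N.-1.+1, 2) = odd (N - i).
    move: par; rewrite (ltn_predK i_lt) binS bin1 oddD oddB 1?ltnW //.
    by case: (odd _) (odd _) (odd i) => [] [] [].
  case: (IHN N.-1 _ (N - i)%N _ parN) => [||H cH Hs]; [lia|lia|].
  have cU : #|union single H| = N by rewrite card_sum card_unit cH; lia.
  have s_le : all (fun k => k <= N)%N
      (0%N :: [seq k <- iota 1 N.-1 | k != (N - i)%N]).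
    by apply/allP => k; rewrite inE mem_filter mem_iota; lia.
  exists (compl (union single H)) => //.
  have := lspec_compl (lspec_union lspec_single Hs); rewrite cU => /(_ s_le).
  apply: lspec_perm; rewrite perm_cons uniq_perm //.
  - rewrite uniq_map_subn // cons_uniq filter_uniq ?iota_uniq //.
    by rewrite mem_filter mem_iota; lia.
  - by rewrite filter_uniq ?iota_uniq.
  by move=> k; rewrite mem_map_subn // inE !mem_filter !mem_iota; lia.
have [N2|N_neq2] := eqVneq N 2%N.
  by subst; exists edge; [exact: card_edge|exact: lspec_edge].
(* Parity rules out 3 and 4, so the gap 2 is admissible for [N - 2]. *)
have N5 : (5 <= N)%N.
  by move: par i_lt N_neq2; rewrite i1; case: (N) => [|[|[|[|[|]]]]].
have parN : odd 'C((N - 2).+1, 2) = odd 2.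
  have NE : N = (N - 2).+2 by lia.
  move: par; rewrite i1 {1}NE binS bin1 binS bin1; move: 'C(_, _) => c.
  by rewrite !oddD /=; case: (odd c); case: (odd (N - 2)).
case: (IHN (N - 2)%N _ 2%N _ parN) => [||H cH Hs]; [lia|lia|].
(* The eigenvalue 2 of [edge] fills the gap of [H]: the union has spectrum 0, 0, 1, ..., N - 2,
   whose complement misses exactly 1. *)
have cU : #|union edge H| = N by rewrite card_sum card_edge cH; lia.
have s_le : all (fun k => k <= N)%N
    [:: 2, 0 & [seq k <- iota 1 (N - 2) | k != 2]]%N.
  by apply/allP => k; rewrite !inE mem_filter mem_iota; lia.
exists (compl (union edge H)) => //.
have := lspec_compl (lspec_union lspec_edge Hs); rewrite cU => /(_ s_le).
apply: lspec_perm; rewrite perm_cons uniq_perm //.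
- rewrite uniq_map_subn // !cons_uniq filter_uniq ?iota_uniq //.
  by rewrite !inE !mem_filter !mem_iota; lia.
- by rewrite filter_uniq ?iota_uniq.
by move=> k; rewrite mem_map_subn // !inE !mem_filter !mem_iota; lia.
Qed.
Lemma S_setE (i j n : nat) :
  (1%N \notin [:: i; j]) ->
  S_set i j n 1 = 1%N :: [seq k <- iota 0 n.+1 | k \notin [:: i; j]].
Proof. by rewrite /S_set /= => ->. Qed.

Lemma S_set_perm (i j n : nat) :
  (1%N \notin [:: i; j]) -> (i < j <= n)%N ->
  perm_eq [:: i, j & S_set i j n 1] (1%N :: iota 0 n.+1).
Proof.
move=> h1 ij; rewrite S_setE // -[_ :: iota _ _]cat1s.
rewrite (perm_catCA [:: i; j] [:: 1%N]) perm_cons uniq_perm ?iota_uniq //.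
  rewrite !cons_uniq filter_uniq ?iota_uniq // !inE !mem_filter !mem_iota !inE.
  by lia.
by move=> k; rewrite [RHS]mem_iota !inE mem_filter mem_iota !inE; lia.
Qed.

Lemma lspec_S_set_realizable (n i : nat) :
  (6 <= n)%N -> (1 < i < n - 1)%N -> odd 'C(n, 2) = odd i ->
  laplacian_realizable [seq k%:R | k <- S_set i (n - 1) n 1].
Proof.
move=> n6 i_bnd par.
have parN : odd 'C(n - 2, 2) = odd (i - 1).
  have nE : n = (n - 2).+2 by lia.
  have -> : odd (i - 1) = ~~ odd i by lia.
  move: par; rewrite {1}nE binS bin1 binS bin1; move: 'C(_, _) => c.
  by rewrite !oddD /=; case: (odd c); case: (odd (n - 2)); case: (odd i).
have h1 : 1%N \notin [:: i; n - 1]%N by rewrite !inE; lia.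
(* In the cone one 0 of [F] becomes the pair 0, [n]; the other listed 0 and the 0 in [s] become the
   double 1, and the rest of [s] is shifted by one. *)
suff [F cF [s [Fs s_le s_uniq s_mem]]] : exists2 F : sgraph, #|F| = (n - 1)%N &
    exists s, [/\ lspec F [:: 0, 0 & s]%N, all (fun k => k <= n - 1)%N s, uniq s
      & forall k, (k \in s) = (k < n - 2)%N && (k != (i - 1)%N)].
  apply: lspec_realizable (cone_connected F) _.
  have := lspec_cone Fs; rewrite cF /= => /(_ s_le); apply: lspec_perm.
  rewrite S_setE //.
  rewrite -[X in perm_eq X]/([:: 0; (n - 1).+1]%N ++ [:: 1]%N ++ map succn s).
  rewrite perm_catCA perm_cons uniq_perm ?filter_uniq ?iota_uniq //.
    rewrite !cons_uniq map_inj_uniq ?s_uniq ?andbT; last exact: succn_inj.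
    apply/andP; split.
      by rewrite !inE; apply/norP; split; [lia|apply/mapP => -[]].
    by rewrite (mem_map succn_inj) s_mem; lia.
  move=> [|k]; rewrite !inE mem_filter mem_iota !inE; first by lia.
  by rewrite (mem_map succn_inj) s_mem; lia.
have [i_lt|i_ge] := ltnP (i - 1) (n - 3).
  have [||H cH Hs] := @lspec_interval_minus (n - 3) (i - 1); [lia| |].
    by rewrite -parN; congr (odd 'C(_, 2)); lia.
  exists (union single (union single H)).
    by rewrite card_sum card_unit card_sum card_unit cH; lia.
  exists (0%N :: [seq k <- iota 1 (n - 3) | k != (i - 1)%N]); split.
  - exact: lspec_union lspec_single (lspec_union lspec_single Hs).
  - by apply/allP => k; rewrite inE mem_filter mem_iota; lia.
  - by rewrite cons_uniq filter_uniq ?iota_uniq // mem_filter mem_iota; lia.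
  by move=> k; rewrite inE mem_filter mem_iota; lia.
(* Now [i - 1 = n - 3] must be missing: the 2 of [edge] fills the gap of a graph on [n - 4]
   vertices, so the values stop at [n - 4]. *)
have iE : i = (n - 2)%N by lia.
have parN4 : odd 'C((n - 4).+1, 2) = odd 2.
  have nE : (n - 2 = (n - 4).+2)%N by lia.
  have e4 : odd (i - 1) = ~~ odd (n - 4) by rewrite iE; lia.
  move: parN; rewrite e4 nE binS bin1; move: 'C(_, _) => c.
  by rewrite oddD /=; case: (odd c); case: (odd (n - 4)).
have n_neq6 : n != 6%N by apply: contraTneq isT => n6'; move: par; rewrite iE n6'.
have [||H cH Hs] := @lspec_interval_minus (n - 4) 2; [lia|done|].
exists (union single (union edge H)).
  by rewrite card_sum card_unit card_sum card_edge cH; lia.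
exists [:: 2, 0 & [seq k <- iota 1 (n - 4) | k != 2]]%N; split.
- apply: lspec_perm (lspec_union lspec_single (lspec_union lspec_edge Hs)).
  by [].
- by apply/allP => k; rewrite !inE mem_filter mem_iota; lia.
- rewrite !cons_uniq filter_uniq ?iota_uniq // !inE !mem_filter !mem_iota.
  by lia.
by move=> k; rewrite !inE mem_filter mem_iota; lia.
Qed.

(** * Necessity: parity of the trace *)

Lemma realizable_lspec (s : seq nat) :
  laplacian_realizable [seq k%:R | k <- s] -> exists G : sgraph, lspec G s.
Proof.
case=> G _ Gs; exists G.
by rewrite /lspec char_poly_spectrum (perm_big _ Gs) big_map.
Qed.

Lemma sum_degree_even (G : sgraph) : ~~ odd (\sum_(x : G) degree x).
Proof.
(* Each edge is counted once, oriented by [enum_rank]. *)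
pose F (x y : G) := ((enum_rank x < enum_rank y)%N && adj x y : nat).
have -> : (\sum_(x : G) degree x = (\sum_(x : G) \sum_(y : G) F x y).*2)%N.
  rewrite -addnn [in RHS]exchange_big -{1}[X in (_ + X)%N]exchange_big /=.
  rewrite -big_split /=; apply: eq_bigr => x _; rewrite degree_sum -big_split.
  apply: eq_bigr => y _; rewrite /F [adj y x]adj_sym.
  case: ltngtP => [||/val_inj/enum_rank_inj ->].
  - by rewrite /= addn0.
  - by rewrite /= add0n.
  - by rewrite adj_irrefl.
by rewrite odd_double.
Qed.

Lemma lspec_sum_even (G : sgraph) (s : seq nat) :
  (0 < #|G|)%N -> lspec G s -> ~~ odd (sumn s).
Proof.
move=> G0 Gs; have sz := lspec_size Gs.
suff -> : sumn s = (\sum_(x : G) degree x)%N by exact: sum_degree_even.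
apply/eqP; rewrite -(eqr_nat algC) sumnE !natr_sum; apply/eqP.
have := char_poly_trace (laplacian algC G) G0; rewrite Gs.
rewrite -(big_map (fun k => k%:R) xpredT (fun z : algC => 'X - z%:P)).
have -> : #|G|.-1 = (size [seq k%:R : algC | k <- s]).-1 by rewrite size_map sz.
rewrite coefPn_prod_XsubC; last first.
  by rewrite size_map sz -lt0n.
move/oppr_inj; rewrite big_map => ->.
rewrite (reindex _ (onW_bij _ (enum_val_bij _))) /=.
by apply: eq_bigr => i _; rewrite laplacianE eqxx adj_irrefl mul1r subr0.
Qed.

(** * Eigenfunctions on the vertices *)

Definition eigenfun (G : sgraph) (k : nat) (z : G -> algC) : Prop :=
  forall x, \sum_(y | adj x y) (z x - z y) = k%:R * z x.

Lemma eigenfun_lincomb (G : sgraph) (k : nat) (y z : G -> algC) (a b : algC) :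
  eigenfun k y -> eigenfun k z -> eigenfun k (fun x => a * y x + b * z x).
Proof.
move=> ey ez x; rewrite mulrDr [_ * (a * _)]mulrCA [_ * (b * _)]mulrCA.
rewrite -ey -ez !mulr_sumr -big_split; apply: eq_bigr => t _ /=; ring.
Qed.

Lemma row_eigenfun (G : sgraph) (k : nat) (v : 'rV[algC]_#|G|) :
  v *m laplacian algC G = k%:R *: v -> eigenfun k (fun x => v 0 (enum_rank x)).
Proof.
move=> ev x; have /matrixP/(_ 0 (enum_rank x)) := ev; rewrite !mxE => <-.
under [RHS]eq_bigr => j _ do rewrite laplacianE enum_rankK mulrBr.
rewrite !sumrB; congr (_ - _).
  rewrite sumr_const [RHS](bigD1 (enum_rank x)) //=.
  rewrite [X in _ = _ + X]big1 ?addr0; last first.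
    by move=> j /negbTE ->; rewrite mul0r mulr0.
  by rewrite eqxx mul1r enum_rankK mulr_natr /degree cardsE.
rewrite big_mkcond (reindex _ (onW_bij _ (enum_val_bij _))) /=.
by apply: eq_bigr => j _; rewrite enum_valK adj_sym mulr_natr mulrb.
Qed.

Lemma laplacian_normal (G : sgraph) : laplacian algC G \is normalmx.
Proof.
apply: symmetric_normalmx.
  apply/is_hermitianmxP; rewrite expr0 scale1r map_mx_id //.
  apply/matrixP => i j; rewrite [RHS]mxE !laplacianE adj_sym eq_sym.
  by have [->|] := eqVneq i j; rewrite ?mul0r.
by apply/mxOverP => i j; rewrite laplacianE rpredB ?rpredM ?realn.
Qed.

(** The Laplacian is real symmetric, so the spectral theorem turns multiplicities of roots into
    numbers of independent eigenfunctions, the rows of [P]. *)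
Lemma laplacian_eigenbasis (G : sgraph) (s : seq nat) :
  lspec G s ->
  exists (P : 'M[algC]_#|G|) (d : 'I_#|G| -> nat),
    [/\ P \in unitmx, perm_eq (codom d) s
      & forall i, eigenfun (d i) (fun x => P i (enum_rank x))].
Proof.
move=> Gs; have /orthomx_spectralP := laplacian_normal G.
set P := spectralmx _; set D := spectral_diag _ => LE.
have Pu : P \in unitmx by exact: unitarymx_unit (spectral_unitarymx _).
have PL : P *m laplacian algC G = diag_mx D *m P.
  by rewrite [X in _ *m X]LE -mulmxA mulKVmx.
have charD : char_poly (laplacian algC G) = char_poly (diag_mx D).
  have detP0 : \det (map_mx polyC P) != 0.
    by rewrite det_map_mx polyC_eq0 -unitfE -unitmxE.
  apply: (mulfI detP0); rewrite [RHS]mulrC -!det_mulmx; congr (\det _).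
  rewrite /char_poly_mx mulmxBr mulmxBl -!map_mxM PL scalar_mxC //.
have DE : perm_eq (codom (D 0)) [seq k%:R | k <- s].
  apply: prod_XsubC_eq; rewrite [RHS]big_map -Gs charD char_poly_trig; last first.
    exact: diag_mx_is_trig.
  rewrite big_map big_enum; apply: eq_bigr => i _.
  by rewrite mxE eqxx mulr1n.
pose d i := Num.truncn (D 0 i).
have dE i : (d i)%:R = D 0 i.
  have : D 0 i \in [seq k%:R | k <- s] by rewrite -(perm_mem DE) codom_f.
  by case/mapP => k _ Dk; rewrite /d Dk natrK.
exists P, d; split => //.
  have -> : codom d = map Num.truncn (codom (D 0)) by rewrite -map_comp.
  apply: perm_trans (perm_map _ DE) _.
  by rewrite -map_comp map_id_in // => k _ /=; rewrite natrK.
move=> i; have := @row_eigenfun G (d i) (row i P).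
have -> : row i P *m laplacian algC G = (d i)%:R *: row i P.
  by rewrite -row_mul PL row_mul row_diag_mx -scalemxAl -rowE dE.
move=> /(_ erefl) e x; have := e x; rewrite !mxE => <-.
by apply: eq_bigr => y _; rewrite !mxE.
Qed.

Lemma lspec_eigenfun (G : sgraph) (s : seq nat) (k : nat) :
  lspec G s -> k \in s ->
  exists2 z : G -> algC, eigenfun k z & exists x, z x != 0.
Proof.
move=> /laplacian_eigenbasis [P [d [Pu ds ed]]].
rewrite -(perm_mem ds) => /codomP [i ->].
exists (fun x => P i (enum_rank x)) => //.
have [x x0|Pi0] := pickP (fun x => P i (enum_rank x) != 0); first by exists x.
have /rowP/(_ i) : row i P *m invmx P = 0.
  have -> : row i P = 0.
    apply/rowP => x; have /negbFE/eqP := Pi0 (enum_val x).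
    by rewrite enum_valK !mxE.
  by rewrite mul0mx.
by rewrite -row_mul mulmxV // !mxE eqxx => /eqP; rewrite oner_eq0.
Qed.

Lemma lspec_eigenfun2 (G : sgraph) (s : seq nat) (k : nat) :
  lspec G s -> (1 < count_mem k s)%N ->
  exists y z : G -> algC, [/\ eigenfun k y, eigenfun k z
    & forall a b, (forall x, a * y x + b * z x = 0) -> a = 0 /\ b = 0].
Proof.
move=> /laplacian_eigenbasis [P [d [Pu ds ed]]].
rewrite -(seq.permP ds) count_map -sum1_count big_enum_cond sum1_card.
case/card_gt1P => i [j [/eqP di /eqP dj ij]].
exists (fun x => P i (enum_rank x)), (fun x => P j (enum_rank x)).
split; [by rewrite -di|by rewrite -dj|move=> a b ab0].
have : a *: row i P + b *: row j P = 0.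
  by apply/rowP => x; have := ab0 (enum_val x); rewrite enum_valK !mxE.
move/(congr1 (fun v => v *m invmx P)).
rewrite mulmxDl -!scalemxAl -!row_mul mulmxV // mul0mx => /rowP e.
have := e i; have := e j; rewrite !mxE !eqxx [j == i]eq_sym (negbTE ij).
by rewrite !mulr1 !mulr0 add0r addr0.
Qed.

(** * Dirichlet energy *)

(** Ordered pairs are summed, giving twice the Dirichlet form of a symmetric [w]. Keeping [w]
    arbitrary lets different graphs on the same vertices be compared. *)
Definition energy (T : finType) (w : rel T) (z : T -> algC) : algC :=
  \sum_x \sum_(y | w x y) `|z x - z y| ^+ 2.

Lemma energyE (T : finType) (w : rel T) (z : T -> algC) : symmetric w ->
  energy w z = 2 * \sum_x (z x)^* * \sum_(y | w x y) (z x - z y).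
Proof.
move=> w_sym.
have -> : energy w z = \sum_x \sum_(y | w x y) (z x)^* * (z x - z y)
                     - \sum_x \sum_(y | w x y) (z y)^* * (z x - z y).
  rewrite -sumrB; apply: eq_bigr => x _; rewrite -sumrB; apply: eq_bigr => y _.
  by rewrite normCK rmorphB -mulrBl mulrC.
rewrite [X in _ - X](exchange_big_dep xpredT) //= mulr_natl mulr2n; congr (_ + _).
  by apply: eq_bigr => x _; rewrite mulr_sumr.
rewrite -sumrN; apply: eq_bigr => x _; rewrite mulr_sumr -sumrN.
rewrite (eq_bigl (w x)) => [|y]; last by rewrite w_sym.
by apply: eq_bigr => y _; rewrite -mulrN opprB.
Qed.

Lemma energy_term_ge0 (T : finType) (z : T -> algC) (x y : T) :
  0 <= `|z x - z y| ^+ 2.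
Proof. by rewrite exprn_ge0 ?normr_ge0. Qed.

Lemma energy_le (T : finType) (w w' : rel T) (z : T -> algC) :
  subrel w w' -> energy w z <= energy w' z.
Proof.
move=> ww'; apply: ler_sum => x _; rewrite big_mkcond [leRHS]big_mkcond.
apply: ler_sum => y _; case: ifP => [/ww' ->//|_].
by case: ifP => // _; apply: energy_term_ge0.
Qed.

Lemma energy_eq0 (T : finType) (w : rel T) (z : T -> algC) :
  energy w z = 0 -> forall x y, w x y -> z x = z y.
Proof.
move=> e0 x y wxy; apply/eqP; rewrite -subr_eq0 -normr_eq0 -sqrf_eq0; apply/eqP.
move: y wxy; apply/psumr_eq0P; first by move=> y _; apply: energy_term_ge0.
move: x (erefl true); apply/psumr_eq0P => // x _; apply: sumr_ge0 => y _.
exact: energy_term_ge0.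
Qed.

Lemma eigenfun_energy (G : sgraph) (k : nat) (z : G -> algC) :
  eigenfun k z -> energy (@adj G) z = (2 * k)%:R * \sum_x `|z x| ^+ 2.
Proof.
move=> ez; rewrite energyE; last exact: adj_sym.
rewrite natrM -mulrA; congr (_ * _); rewrite mulr_sumr; apply: eq_bigr => x _.
by rewrite ez normCK mulrCA [z x * _]mulrC.
Qed.

Lemma eigenfun_sum0 (G : sgraph) (k : nat) (z : G -> algC) :
  (0 < k)%N -> eigenfun k z -> \sum_x z x = 0.
Proof.
move=> k_gt0 ez; pose S := \sum_(x : G) \sum_(y | adj x y) (z x - z y).
have S0 : S = 0.
  suff SN : S = - S.
    apply/eqP; rewrite -[_ == _]/((2 == 0)%N || (S == 0)) -mulrn_eq0.
    by rewrite mulr2n {1}SN addNr.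
  rewrite /S {2}(exchange_big_dep xpredT) //= -sumrN; apply: eq_bigr => x _.
  rewrite -sumrN; apply: eq_big => [y|y _]; first by rewrite adj_sym.
  by rewrite opprB.
have : k%:R * \sum_x z x = S.
  by rewrite mulr_sumr; apply: eq_bigr => x _; rewrite ez.
by rewrite S0 => /eqP; rewrite mulf_eq0 pnatr_eq0 -leqn0 leqNgt k_gt0 => /eqP.
Qed.

(** Since [z] sums to 0, it is an eigenfunction of the complement for [#|G| - k]. The pairs [x = y]
    also satisfy the relation but contribute 0. *)
Lemma eigenfun_nonadj_energy (G : sgraph) (k : nat) (z : G -> algC) :
  (0 < k)%N -> eigenfun k z ->
  energy (fun x y => ~~ adj x y) z = 2 * (#|G|%:R - k%:R) * \sum_x `|z x| ^+ 2.
Proof.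
move=> k_gt0 ez; have z0 := eigenfun_sum0 k_gt0 ez.
rewrite energyE; last by move=> x y; rewrite adj_sym.
rewrite -mulrA; congr (_ * _); rewrite mulr_sumr; apply: eq_bigr => x _.
have : \sum_y (z x - z y) = #|G|%:R * z x.
  by rewrite sumrB z0 subr0 sumr_const mulr_natl.
rewrite (bigID (adj x)) /= ez => /(canRL (addKr _)) ->; rewrite normCK; ring.
Qed.

Lemma universal_eigenfun0 (G : sgraph) (k : nat) (z : G -> algC) (v : G) :
  (0 < k < #|G|)%N -> (forall x, x != v -> adj v x) -> eigenfun k z -> z v = 0.
Proof.
case/andP=> k_gt0 k_lt v_univ ez; have z0 := eigenfun_sum0 k_gt0 ez.
have := ez v; rewrite (eq_bigl (fun x => x != v)) => [|x]; last first.
  by have [->|/v_univ] := eqVneq x v; first exact: adj_irrefl.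
have : \sum_y (z v - z y) = #|G|%:R * z v.
  by rewrite sumrB z0 subr0 sumr_const mulr_natl.
rewrite (bigD1 v) //= subrr add0r => -> /eqP; rewrite -subr_eq0 -mulrBl mulf_eq0.
by rewrite subr_eq0 eqr_nat gtn_eqF // => /eqP.
Qed.

(** As [z] sums to 0 on [D], half the energy is the sum of degree times [|z x|^2] plus, for each
    part, the squared modulus of the sum of [z] over it. *)
Lemma multipartite_energy (T I : finType) (D : {set T}) (f : T -> I)
    (z : T -> algC) (d : nat) :
  \sum_(x in D) z x = 0 ->
  {in D, forall x, (d <= #|[set y in D | f y != f x]|)%N} ->
  2 * d%:R * \sum_(x in D) `|z x| ^+ 2
    <= energy (fun x y => [&& x \in D, y \in D & f y != f x]) z.
Proof.
move=> z0 d_le; rewrite energyE; last first.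
  by move=> x y; rewrite andbCA eq_sym.
rewrite -mulrA ler_pM2l ?ltr0n // mulr_sumr.
pose same x := \sum_(y in D | f y == f x) z y.
have -> : \sum_x (z x)^* *
      (\sum_(y | [&& x \in D, y \in D & f y != f x]) (z x - z y))
    = \sum_(x in D) (#|[set y in D | f y != f x]|%:R * `|z x| ^+ 2
                     + (z x)^* * same x).
  rewrite [RHS]big_mkcond; apply: eq_bigr => x _; case: ifP => xD /=; last first.
    by rewrite big_pred0_eq mulr0.
  rewrite sumrB sumr_const cardsE normCK -mulr_natl.
  have -> : \sum_(y in D | f y != f x) z y = - same x.
    move: z0; rewrite (bigID (fun y => f y == f x)) /= => /eqP.
    by rewrite addrC addr_eq0 => /eqP.
  by rewrite opprK; ring.
rewrite big_split /=.
have same_ge0 : 0 <= \sum_(x in D) (z x)^* * same x.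
  rewrite (partition_big f xpredT) //=; apply: sumr_ge0 => i _.
  have -> : \sum_(x in D | f x == i) (z x)^* * same x
      = `|\sum_(x in D | f x == i) z x| ^+ 2.
    rewrite normCK mulrC rmorph_sum mulr_suml; apply: eq_bigr => x /andP[_ /eqP fx].
    by rewrite /same fx.
  by rewrite exprn_ge0 ?normr_ge0.
apply: le_trans (ler_wpDr same_ge0 (lexx _)).
by apply: ler_sum => x xD; rewrite ler_wpM2r ?exprn_ge0 ?normr_ge0 // ler_nat d_le.
Qed.

(** Has the level sets of [f] but values in a finite type, as [multipartite_energy] requires; [f]
    itself takes values in [algC] or pairs. *)
Definition fiber (T : finType) (I : eqType) (f : T -> I) (x : T) : {set T} :=
  [set y | f y == f x].

Lemma eq_fiber (T : finType) (I : eqType) (f : T -> I) (x y : T) :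
  (fiber f x == fiber f y) = (f x == f y).
Proof.
apply/eqP/eqP => [/setP/(_ x)|fxy]; first by rewrite !inE eqxx => /esym/eqP.
by rewrite /fiber fxy.
Qed.

Lemma sum_sqr_gt0 (T : finType) (z : T -> algC) :
  (exists x, z x != 0) -> 0 < \sum_x `|z x| ^+ 2.
Proof.
case=> x x0; rewrite (bigD1 x) //= ltr_wpDr ?exprn_gt0 ?normr_gt0 //.
by apply: sumr_ge0 => y _; rewrite exprn_ge0.
Qed.

(** * Incompatible eigenvalues *)

Lemma universal_vertex (G : sgraph) (s : seq nat) :
  (1 < #|G|)%N -> lspec G s -> #|G| \in s -> 1%N \in s ->
  exists v : G, forall x, x != v -> adj v x.
Proof.
move=> G_gt1 Gs /(lspec_eigenfun Gs)[x ex xn0] /(lspec_eigenfun Gs)[y ey yn0].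
have G_gt0 : (0 < #|G|)%N by apply: ltnW.
have x_adj a b : x a != x b -> adj a b.
  apply: contraNT => ab; apply/eqP; move: a b ab; apply: energy_eq0.
  by rewrite (eigenfun_nonadj_energy G_gt0 ex) subrr mulr0 mul0r.
pose f := fiber x.
(* Distinct level sets of [x] are completely joined. If each missed two vertices, the energy of [y]
   would be at least 4 times its squared norm, while eigenvalue 1 gives 2 times. *)
have [/existsP[a a_le]|/existsPn a_gt] :=
    boolP [exists a, (#|[set b in [set: G] | f b != f a]| <= 1)%N]; last first.
  have := multipartite_energy (D := [set: G]) (f := f) (z := y) (d := 2) _ _.
  have sumT (F : G -> algC) : \sum_(a in [set: G]) F a = \sum_a F a.
    by apply: eq_bigl => a; rewrite inE.
  rewrite !sumT (eigenfun_sum0 (ltn0Sn 0) ey) => /(_ erefl) le2.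
  have : 2 * 2 * \sum_a `|y a| ^+ 2 <= energy (@adj G) y.
    apply: le_trans (le2 _) (energy_le _ _).
      by move=> a _; rewrite ltnNge a_gt.
    by move=> a b /and3P[_ _]; rewrite eq_fiber eq_sym => /x_adj.
  rewrite (eigenfun_energy ey).
  rewrite -subr_ge0 -mulrBl pmulr_lge0 ?sum_sqr_gt0 //.
  by rewrite -natrM subr_ge0 ler_nat.
(* Being nonzero with sum 0, [x] is not constant: the level set of [a] misses exactly one vertex. *)
have [b fba] : exists b, x b != x a.
  apply/existsP; apply: contraT => /existsPn xa.
  have xE c : x c = x a by apply/eqP/negbNE/xa.
  have := eigenfun_sum0 G_gt0 ex; rewrite (eq_bigr _ (fun c _ => xE c)) sumr_const.
  move/eqP; rewrite mulrn_eq0 gtn_eqF //=; case: xn0 => c; rewrite xE => xa0.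
  by rewrite (negbTE xa0).
exists b => c cb; apply: x_adj; apply: contraNneq cb => xbc; apply/eqP.
apply: (card_le1_eqP a_le); rewrite !inE eq_fiber //.
by rewrite -xbc.
Qed.

(** As [y v = 0], the edge from [x] to [v] contributes [y x], all of [1 * y x]. So the Laplacian of
    the graph without [v] kills [y]. *)
Lemma eigenfun1_adj_eq (G : sgraph) (y : G -> algC) (v : G) :
  (1 < #|G|)%N -> (forall x, x != v -> adj v x) -> eigenfun 1 y ->
  forall a b, a != v -> b != v -> adj a b -> y a = y b.
Proof.
move=> G_gt1 v_univ ey; have yv : y v = 0 by apply: universal_eigenfun0 ey.
have v_adj x : adj v x = (x != v).
  by have [->|/v_univ] := eqVneq x v; first exact: adj_irrefl.
pose w a b := [&& a != v, b != v & adj a b].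
suff w0 : energy w y = 0.
  by move=> a b av bv ab; apply: (energy_eq0 w0); rewrite /w av bv.
rewrite energyE => [|a b]; last by rewrite /w andbCA adj_sym.
rewrite big1 ?mulr0 // => x _.
have [->|xv] := eqVneq x v; first by rewrite yv rmorph0 mul0r.
have := ey x; rewrite (bigD1 v) /=; last by rewrite adj_sym v_adj.
rewrite yv subr0 mul1r => /(canRL (addKr _)); rewrite addNr => e0.
rewrite (eq_bigl (fun t => adj x t && (t != v))) ?e0 ?mulr0 // => t.
by rewrite /w xv /= andbC.
Qed.

Lemma pred_card_notin_lspec (G : sgraph) (s : seq nat) :
  (1 < #|G|)%N -> lspec G s -> #|G| \in s -> (1 < count_mem 1%N s)%N ->
  #|G|.-1 \notin s.
Proof.
move=> G_gt1 Gs n_s one_s; apply/negP => n1_s.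
have one_in : 1%N \in s by rewrite -has_pred1 has_count (ltnW one_s).
have [v v_univ] := universal_vertex G_gt1 Gs n_s one_in.
have [y [y' [ey ey' free]]] := lspec_eigenfun2 Gs one_s.
have [z ez zn0] := lspec_eigenfun Gs n1_s.
have yv : y v = 0 by apply: universal_eigenfun0 ey.
have y'v : y' v = 0 by apply: universal_eigenfun0 ey'.
have zv : z v = 0 by apply: universal_eigenfun0 ez => //; lia.
pose e x := (y x, y' x); pose D := [set~ v].
have sumD (F : G -> algC) : F v = 0 -> \sum_(x in D) F x = \sum_x F x.
  move=> Fv; rewrite [RHS](bigD1 v) //= Fv add0r.
  by apply: eq_bigl => x; rewrite !inE.
have e_adj a b : a \in D -> b \in D -> e a != e b -> ~~ adj a b.
  rewrite !inE => av bv; apply: contraNN => ab; apply/eqP; congr pair.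
    exact: (eigenfun1_adj_eq G_gt1 v_univ ey).
  exact: (eigenfun1_adj_eq G_gt1 v_univ ey').
have n1_gt0 : (0 < #|G|.-1)%N by lia.
have [/existsP[a /andP[aD a_le]]|/existsPn a_gt] :=
    boolP [exists a, (a \in D) && (#|[set b in D | fiber e b != fiber e a]| <= 1)%N].
  have [b eb] : exists b, forall c, c \in D -> c != b -> e c = e a.
    have [b|none] := pickP [pred b in D | fiber e b != fiber e a].
      move=> bP; exists b => c cD cb; apply/eqP; apply: contraNT cb => eca.
      by apply/eqP/(card_le1_eqP a_le); rewrite inE // cD eq_fiber.
    exists a => c cD _; apply/eqP; have := none c.
    by rewrite inE cD eq_fiber => /negbFE.
  (* A combination vanishing at [a] vanishes off [b], hence also at [b] because it sums to 0. *)
  have vanish p q : p * y a + q * y' a = 0 -> p = 0 /\ q = 0.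
    move=> pq0; pose g x := p * y x + q * y' x; apply: free.
    have g_b x : x != b -> g x = 0.
      move=> xb; have [->|xv] := eqVneq x v.
        by rewrite /g yv y'v !mulr0 addr0.
      have [yx y'x] : y x = y a /\ y' x = y' a.
        have xD : x \in D by rewrite !inE.
        by have := eb x xD xb; rewrite /e => -[-> ->].
      by rewrite /g yx y'x.
    have := eigenfun_sum0 (ltn0Sn 0) (eigenfun_lincomb p q ey ey').
    rewrite (bigD1 b) //= big1 => [|x /g_b //]; rewrite addr0 => gb x.
    by have [->|/g_b] := eqVneq x b.
  (* The coefficients [y' a] and [- y a] cancel at [a], so both values are 0; then 1 and 0 also
     cancel there. *)
  have [y'a /eqP] : y' a = 0 /\ - y a = 0 by apply: vanish; ring.
  rewrite oppr_eq0 => /eqP ya.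
  have [|/eqP] := vanish 1 0; first by rewrite ya y'a; ring.
  by rewrite oner_eq0.
have zD : \sum_(x in D) z x = 0 by rewrite sumD // (eigenfun_sum0 n1_gt0 ez).
have := multipartite_energy (f := fiber e) (d := 2) zD _.
rewrite sumD ?zv ?normr0 ?expr0n // => le2.
(* In the complement [z] has eigenvalue 1, against the lower bound 2. *)
have : 2 * 2 * \sum_x `|z x| ^+ 2 <= energy (fun x y => ~~ adj x y) z.
  apply: le_trans (le2 _) (energy_le _ _).
    by move=> a aD; rewrite ltnNge; have := a_gt a; rewrite aD.
  by move=> a b /and3P[aD bD]; rewrite eq_fiber eq_sym => /(e_adj _ _ aD bD).
rewrite (eigenfun_nonadj_energy n1_gt0 ez) -natrB ?leq_pred //.
have -> : (#|G| - #|G|.-1 = 1)%N by lia.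
rewrite -subr_ge0 -mulrBl pmulr_lge0 ?sum_sqr_gt0 //.
by rewrite -!natrM subr_ge0 ler_nat.
Qed.

(** * Parity and the four residue classes *)

Lemma odd_bin2 (n : nat) : odd 'C(n, 2) = (2 <= n %% 4)%N.
Proof.
elim: n => [|n IHn]; first by rewrite mod0n.
by rewrite binS bin1 oddD IHn; lia.
Qed.

Local Close Scope ring_scope.

Theorem theorem3p2 (n i j : nat) (hn : 6 <= n) (hi : 0 < i) (hij : i < j)
    (hjn : j < n) (h1 : 1 \notin [:: i; j]) :
  laplacian_realizable [seq (k%:R)%R | k <- S_set i j n 1] <->
  j = n - 1 /\
  [\/ n = 0 %[mod 4] /\ exists2 k : nat, 1 <= k <= (n - 2) %/ 2 & i = 2 * k,
      n = 1 %[mod 4] /\ exists2 k : nat, 1 <= k <= (n - 3) %/ 2 & i = 2 * k,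
      n = 2 %[mod 4] /\ exists2 k : nat, 1 <= k <= (n - 4) %/ 2 & i = 2 * k + 1
    | n = 3 %[mod 4] /\ exists2 k : nat, 1 <= k <= (n - 3) %/ 2 & i = 2 * k + 1].
Proof.
have [i_neq1 j_neq1] : i <> 1 /\ j <> 1 by move: h1; rewrite !inE; lia.
have ij : i < j <= n by rewrite hij ltnW.
split=> [/realizable_lspec[G Gs]|[jE cases]]; last first.
  rewrite jE; apply: lspec_S_set_realizable => //; first by lia.
  rewrite odd_bin2.
  by case: cases => -[nm [k k_bnd iE]]; rewrite nm iE; lia.
have permS := S_set_perm h1 ij.
have nE : #|G| = n.
  by have := perm_size permS; rewrite /= size_iota (lspec_size Gs) => -[].
have mem_S k : k <= n -> k != i -> k != j -> k \in S_set i j n 1.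
  by move=> kn ki kj; rewrite S_setE // inE mem_filter mem_iota !inE; lia.
have jE : j = n - 1.
  apply/eqP; apply: contraT => j_neq.
  have := @pred_card_notin_lspec G _ _ Gs; rewrite nE => /(_ _ _ _)/negP[]; first lia.
  - by apply: mem_S; lia.
  - rewrite S_setE // -cat1s count_cat (_ : count_mem 1 [:: 1] = 1) // add1n.
    by rewrite ltnS -has_count has_pred1 mem_filter mem_iota h1; lia.
  by apply: mem_S; lia.
have parity : odd 'C(n, 2) = odd i.
  have := lspec_sum_even _ Gs; rewrite nE => /(_ (leq_trans (ltn0Sn 5) hn)).
  (* Restoring [i] and [j] leaves 1 and the numbers 0, ..., n, whose sum is
     ['C(n.+1, 2) = 'C(n, 2) + n]. *)
  have sumS : i + (j + sumn (S_set i j n 1)) = 1 + 'C(n, 2) + n.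
    have -> : 1 + 'C(n, 2) + n = sumn (1 :: iota 0 n.+1).
      rewrite -addnA -{2}(bin1 n) -binS -bin2_sum -sumnE /index_iota subn0.
      by [].
    by rewrite -(perm_sumn permS).
  move: sumS; rewrite jE; lia.
split=> //; move: parity; rewrite odd_bin2.
have : n %% 4 < 4 by rewrite ltn_mod.
case r: (n %% 4) => [|[|[|[|]]]] //= _ par.
- by constructor 1; split=> //; exists (i %/ 2); lia.
- by constructor 2; split=> //; exists (i %/ 2); lia.
- by constructor 3; split=> //; exists (i %/ 2); lia.
- by constructor 4; split=> //; exists (i %/ 2); lia.
Qed.
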